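(* Let $\mathcal P$ be a finite poset and let $\mu,\nu$ be probability measures on $\mathcal P$. If $\mu\preceq_{HS}\nu$ (that is, $\mu$ is dominated by $\nu$ in the hockey-stick order), then $$d_{\zeta}(\mu,\nu)=\frac12\, m_2[\nu-\mu].$$
   Context: Let $\mathcal P$ be a finite poset with order $\le$. For $x\le y$ let $\mu_{\mathcal P}(x,y)$ be the Möbius function of $\mathcal P$, i.e. the inverse of the zeta function $\zeta(x,y)=1$ ($x\le y$) under incidence convolution: $\sum_{x\le y\le z}\mu_{\mathcal P}(x,y)=1$ if $x=z$ and $0$ if $x<z$. For $f:\mathcal P\to\mathbb R$ define the poset integral $I[f](x)=\sum_{y\le x}f(y)$ and the poset derivative $D[f](x)=\sum_{y\le x}f(y)\,\mu_{\mathcal P}(y,x)$; $I^d$, $D^d$ denote $d$-fold iterates. Let $\mathbf 1$ be the constant function $1$. The power functions are $\phi_d^{\mathcal P}:=d!\,I^d[\mathbf 1]$. For a signed measure $\rho$ on $\mathcal P$ and $f:\mathcal P\to\mathbb R$, write $\langle\rho,f\rangle:=\int_{\mathcal P}f(x)\,\rho(dx)$. The moment of order $d$ of $\rho$ is $m_d[\rho]:=\langle\rho,\phi_d^{\mathcal P}\rangle$. The hockey-stick functions are $\Phi_x^{\mathcal P}(z):=\sum_{y\in\mathcal P}\mathbb 1_{\{x\le y\le z\}}$, for $x,z\in\mathcal P$. For signed measures $\mu,\nu$ on $\mathcal P$, $\mu\preceq_{HS}\nu$ means $\langle\nu-\mu,\Phi_x^{\mathcal P}\rangle\ge0$ for every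 $x\in\mathcal P$. For probability measures $\mu,\nu$ on $\mathcal P$, $$d_\zeta(\mu,\nu):=\sup\{|\langle\nu-\mu,f\rangle| : f:\mathcal P\to\mathbb R,\ \|D^2[f]\|_\infty\le1\},$$ where $\|\cdot\|_\infty$ is the supremum norm on functions on $\mathcal P$. *)

(* Defs.v *)
From HB Require Import structures.
From mathcomp Require Import all_boot all_order all_algebra.
From mathcomp Require Import all_classical all_reals all_analysis.

Set Implicit Arguments.
Unset Strict Implicit.
Unset Printing Implicit Defensive.

Import Order.TTheory GRing.Theory Num.Theory.
Import numFieldNormedType.Exports.

Local Open Scope classical_set_scope.
Local Open Scope ring_scope.

Section Mobius.
Context {disp : Order.disp_t} {P : finPOrderType disp}.

(* The inverse of the zeta function solves mu(x,x) = 1 and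
   mu(x,z) = - \sum_(x <= y < z) mu(x,y) for x < z; [n] bounds the recursion
   depth, and #|P| is enough fuel since chains of P have at most #|P| elements.
   The value is 0 unless x <= z. [sum_mobius] is the defining identity. *)
Fixpoint mobius_rec (n : nat) (x z : P) : int :=
  if n is m.+1 then
    if x == z then 1
    else if (x < z)%O then - \sum_(y | (x <= y < z)%O) mobius_rec m x y
    else 0
  else 0.

Definition mobius (x z : P) : int := mobius_rec #|P| x z.

Let card_itv (x z : P) : nat := #|[pred y | (x <= y <= z)%O]|.

Let card_itv_lt (x y z : P) : (x <= y < z)%O -> (card_itv x y < card_itv x z)%N.
Proof.
move=> /andP[xy yz]; apply/proper_card/properP; split.
  apply/fintype.subsetP => t; rewrite !inE => /andP[-> ty].
  exact: le_trans ty (ltW yz).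
exists z; rewrite !inE ?(le_trans xy (ltW yz)) ?lexx //=.
by rewrite (lt_geF yz).
Qed.

Let mobius_rec_fuel (n m : nat) (x z : P) :
  (card_itv x z <= n)%N -> (card_itv x z <= m)%N ->
  mobius_rec n x z = mobius_rec m x z.
Proof.
have card0 (y : P) : (x <= y)%O -> (0 < card_itv x y)%N.
  by move=> xy; apply/card_gt0P; exists x; rewrite !inE lexx xy.
have nle k (y : P) : ~~ (x <= y)%O -> mobius_rec k x y = 0.
  case: k => //= k xy; case: eqP => [xE|_]; first by rewrite xE lexx in xy.
  by case: ifP => // /ltW; rewrite (negbTE xy).
elim: n m z => [|n IH] [|m] z hn hm //;
  case: (boolP (x <= z)%O) => [/card0|xz];
  rewrite ?(nle _ _ xz) //; try by rewrite ltnNge ?hn ?hm.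
move=> _ /=; do 2?case: ifP => // _; congr (- _).
apply: eq_bigr => y /card_itv_lt lt_yz.
by apply: IH; rewrite -ltnS; exact: leq_trans lt_yz _.
Qed.

Lemma sum_mobius (x z : P) : (x <= z)%O ->
  \sum_(y | (x <= y <= z)%O) mobius x y = (x == z)%:R.
Proof.
move=> xz; rewrite (bigD1 z) ?xz ?lexx //=.
have -> : \sum_(y | (x <= y <= z)%O && (y != z)) mobius x y
        = \sum_(y | (x <= y < z)%O) mobius x y.
  apply: eq_bigl => y; rewrite lt_neqAle -andbA; congr (_ && _).
  by rewrite andbC.
have cardP : (0 < #|P|)%N by apply/card_gt0P; exists x.
rewrite {1}/mobius -(ltn_predK cardP) /=.
case: (eqVneq x z) => [->|nxz].
  rewrite big1 ?addr0 // => y /andP[zy yz].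
  by move: (le_lt_trans zy yz); rewrite ltxx.
rewrite lt_neqAle nxz xz /=.
rewrite (_ : \sum_(y | _) mobius_rec _ _ _
           = \sum_(y | (x <= y < z)%O) mobius x y) ?addNr //.
apply: eq_bigr => y xyz; apply: mobius_rec_fuel; last exact: max_card.
rewrite -ltnS (ltn_predK cardP).
exact: leq_trans (card_itv_lt xyz) (max_card _).
Qed.

End Mobius.

Section PosetCalculus.
Context {R : realType} {disp : Order.disp_t} {P : finPOrderType disp}.

Definition poset_int (f : P -> R) (x : P) : R := \sum_(y | (y <= x)%O) f y.

Definition poset_deriv (f : P -> R) (x : P) : R :=
  \sum_(y | (y <= x)%O) f y * (mobius y x)%:~R.

Definition power_fun (d : nat) (x : P) : R :=
  d`!%:R * iter d poset_int (cst 1) x.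

Definition hockey_stick (x z : P) : R := \sum_(y : P) ((x <= y <= z)%O)%:R.

Definition sup_norm (f : P -> R) : R := sup (range (fun x => `|f x|)).

End PosetCalculus.

(* T with the discrete sigma-algebra. The library's
   measurable spaces are pointed, whence the parameter [x0], which plays no
   other role: a poset carrying a probability measure is never empty. *)
Definition discrete_space (T : Type) (x0 : T) : Type := T.

HB.instance Definition _ (T : choiceType) (x0 : T) :=
  Choice.on (discrete_space x0).
HB.instance Definition _ (T : choiceType) (x0 : T) :=
  isPointed.Build (discrete_space x0) x0.
HB.instance Definition _ (T : choiceType) (x0 : T) :=
  @isMeasurable.Build default_measure_display (discrete_space x0)
    (@discrete_measurable (discrete_space x0))
    (@discrete_measurable0 _) (@discrete_measurableC _)
    (@discrete_measurableU _).

Section SignedMeasures.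
Context {d : measure_display} {T : measurableType d} {R : realType}.

Lemma ex_hahn_pair (rho : {charge set T -> \bar R}) :
  exists PN : set T * set T, hahn_decomposition rho PN.1 PN.2.
Proof. by have [P [N PN]] := Hahn_decomposition rho; exists (P, N). Qed.

(* The integral against a signed measure is the difference of the integrals
   against the positive and negative parts of its Jordan decomposition. *)
Definition charge_integral (rho : {charge set T -> \bar R}) (f : T -> R) : R :=
  let PN := projT2 (cid (ex_hahn_pair rho)) in
  (\int[jordan_pos PN]_x f x) - (\int[jordan_neg PN]_x f x).

Definition charge_diff (nu mu : {charge set T -> \bar R}) :
    {charge set T -> \bar R} := cadd nu (copp mu).

End SignedMeasures.

Section PosetMeasures.
Context {R : realType} {disp : Order.disp_t} {P : finPOrderType disp} {x0 : P}.

Local Notation D := (discrete_space x0).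

Definition moment (d : nat) (rho : {charge set D -> \bar R}) : R :=
  charge_integral rho (power_fun d : P -> R).

Definition hs_le (mu nu : {charge set D -> \bar R}) : Prop :=
  forall x : P,
    0 <= charge_integral (charge_diff nu mu) (hockey_stick x : P -> R).

Definition d_zeta (mu nu : probability D R) : \bar R :=
  let rho := charge_diff (charge_of_finite_measure nu)
                         (charge_of_finite_measure mu) in
  ereal_sup [set `|charge_integral rho f|%:E
            | f in [set f : P -> R | sup_norm (iter 2 poset_deriv f) <= 1]].

End PosetMeasures.

(* Main.v *)
Require Import Defs.
From HB Require Import structures.
From mathcomp Require Import all_boot all_order all_algebra.
From mathcomp Require Import all_classical all_reals all_analysis.
Import Order.TTheory GRing.Theory Num.Theory.
Import numFieldNormedType.Exports.
Local Open Scope classical_set_scope.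
Local Open Scope ring_scope.

(** Write [g := D^2 f]. Since [I] and [D] are mutually inverse,
[f = I^2 g = \sum_x g x * Phi_x], so [<rho, f> = \sum_x g x * <rho, Phi_x>].
When every [<rho, Phi_x>] is nonnegative and [|g| <= 1], this is at most
[\sum_x <rho, Phi_x> = <rho, I^2 1> = m_2 / 2] in absolute value, with equality
for [f = I^2 1], whose second derivative is [1]. *)

Section PosetCalculus.
Context {R : realType} {disp : Order.disp_t} {P : finPOrderType disp}.
Implicit Types f g : P -> R.

(** After exchanging the two sums, the weight of [f x] at [z] is the sum of [mobius x y] over
    [x <= y <= z], so [sum_mobius] kills every term but [x = z]. *)
Lemma poset_derivK f : poset_int (poset_deriv f) = f.
Proof.
apply/funext => z; rewrite /poset_int /poset_deriv.
rewrite (exchange_big_dep (fun x => x <= z)%O) /=; last first.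
  by move=> y x yz xy; exact: le_trans xy yz.
rewrite (bigD1 z) ?lexx//= [X in _ + X]big1 => [|x /andP[xz nxz]].
  rewrite addr0 -mulr_sumr -rmorph_sum /=.
  rewrite (eq_bigl (fun y => (z <= y <= z)%O)) => [|y]; last by rewrite andbC.
  by rewrite sum_mobius// eqxx mulr1.
rewrite -mulr_sumr -rmorph_sum /=.
rewrite (eq_bigl (fun y => (x <= y <= z)%O)) => [|y]; last by rewrite andbC.
by rewrite sum_mobius// (negbTE nxz) mulr0.
Qed.

(** Summation over down-sets is unitriangular: by induction on the size of the down-set of [z], the
    values strictly below [z] agree and cancel. *)
Lemma poset_int_inj : injective (@poset_int R disp P).
Proof.
move=> f g fg; apply/funext => z.
have [n] := ubnP #|[pred y | (y <= z)%O]|.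
elim: n z => // n IH z; rewrite ltnS => zn.
have := congr1 (@^~ z) fg; rewrite /poset_int (bigD1 z)//= [RHS](bigD1 z)//=.
rewrite (eq_bigr g) => [/addIr //|y /andP[yz nyz]].
apply: IH; apply: leq_trans zn; apply/proper_card/properP; split.
  by apply/fintype.subsetP => t; rewrite !inE => /le_trans; apply.
by exists z; rewrite !inE ?lexx// lt_geF// lt_neqAle nyz.
Qed.

(** An injective map with a right inverse is inverted by it on both sides; this avoids the dual
    Möbius identity, which sums over the first argument. *)
Lemma poset_intK f : poset_deriv (poset_int f) = f.
Proof. by apply: poset_int_inj; rewrite poset_derivK. Qed.

Lemma iter2_poset_int f z :
  iter 2 poset_int f z = \sum_x f x * hockey_stick x z.
Proof.
rewrite /= {1}/poset_int /poset_int /hockey_stick.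
rewrite (exchange_big_dep predT)//=; apply: eq_bigr => x _.
rewrite mulr_sumr big_mkcond/=; apply: eq_bigr => y _.
by rewrite andbC; case: ifP => _; rewrite ?mulr1 ?mulr0.
Qed.

Lemma sup_norm_le1 (x0 : P) f :
  (sup_norm f <= 1) <-> (forall x, `|f x| <= 1).
Proof.
split=> [f1 x|f1].
  apply: le_trans f1; apply: ub_le_sup; last by exists x.
  (* An upper bound of the range must be exhibited, since [sup] takes a default value on unbounded
     sets. *)
  exists (\sum_y `|f y|) => _ [y _ <-].
  by rewrite (bigD1 y)//= lerDl sumr_ge0.
apply: ge_sup; first by exists `|f x0|; exists x0.
by move=> _ [y _ <-].
Qed.

End PosetCalculus.

Section ChargeIntegral.
Context {R : realType} {disp : Order.disp_t} {P : finPOrderType disp} {x0 : P}.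
Local Notation D := (discrete_space x0).

(** Every function is measurable for the discrete sigma-algebra, and finiteness of [P] bounds it by
    the sum of its absolute values. *)
Lemma discrete_integrable (m : {finite_measure set D -> \bar R}) (f : D -> R) :
  m.-integrable setT (EFin \o f).
Proof.
apply: measurable_bounded_integrable => //.
  by rewrite fin_num_fun_lty//; exact: fin_num_measure.
exists (\sum_(y : P) `|f y|); split; first exact: num_real.
move=> M /ltW fM y _ /=; apply: le_trans fM.
by rewrite (bigD1 (y : P))//= lerDl sumr_ge0.
Qed.

Lemma Rintegral_sum (m : {finite_measure set D -> \bar R})
    (g : P -> R) (h : P -> D -> R) (s : seq P) :
  \int[m]_z (\sum_(x <- s) g x * h x z) = \sum_(x <- s) g x * \int[m]_z h x z.
Proof.
elim: s => [|x s IH].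
  rewrite big_nil; under eq_Rintegral do rewrite big_nil.
  by rewrite Rintegral_cst// mul0r.
rewrite big_cons -IH -RintegralZl//; last exact: discrete_integrable.
rewrite -RintegralD//; try exact: discrete_integrable.
by apply: eq_Rintegral => z _; rewrite big_cons.
Qed.

(** The Hahn decomposition is chosen from [rho] alone, so all integrands share the same two finite
    Jordan parts and linearity passes to the difference. *)
Lemma charge_integral_sum (rho : {charge set D -> \bar R})
    (g : P -> R) (h : P -> D -> R) :
  charge_integral rho (fun z => \sum_x g x * h x z) =
  \sum_x g x * charge_integral rho (h x).
Proof.
rewrite /charge_integral !Rintegral_sum -sumrB.
by apply: eq_bigr => x _; rewrite mulrBr.
Qed.

Lemma charge_integral_iter2 (rho : {charge set D -> \bar R}) (g : P -> R) :
  charge_integral rho (iter 2 poset_int g : P -> R) =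
  \sum_(x : P) g x * charge_integral rho (hockey_stick x : P -> R).
Proof.
rewrite -charge_integral_sum; congr charge_integral.
by apply/funext => z; exact: iter2_poset_int.
Qed.

Lemma moment2E (rho : {charge set D -> \bar R}) :
  2^-1 * moment 2 rho =
  \sum_(x : P) charge_integral rho (hockey_stick x : P -> R).
Proof.
(* The factor [2!] is moved inside as the constant weight 2, so that [charge_integral_iter2]
   applies. *)
have -> : moment 2 rho = charge_integral rho
    (iter 2 poset_int (cst 2 : P -> R) : P -> R).
  rewrite /moment; congr charge_integral; apply/funext => z.
  rewrite /power_fun !iter2_poset_int mulr_sumr.
  by apply: eq_bigr => x _; rewrite mul1r.
rewrite charge_integral_iter2 mulr_sumr; apply: eq_bigr => x _.
by rewrite mulrA mulVf ?mul1r ?pnatr_eq0.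
Qed.

End ChargeIntegral.

Theorem theorem1p1 (R : realType) (disp : Order.disp_t)
    (P : finPOrderType disp) (x0 : P)
    (mu nu : probability (discrete_space x0) R) :
  hs_le (charge_of_finite_measure mu) (charge_of_finite_measure nu) ->
  d_zeta mu nu =
  (2^-1 * moment 2 (charge_diff (charge_of_finite_measure nu)
                                (charge_of_finite_measure mu)))%:E.
Proof.
rewrite /hs_le /d_zeta; set rho := charge_diff _ _ => hs.
rewrite moment2E; apply/eqP; rewrite eq_le; apply/andP; split.
  apply: ge_ereal_sup => _ [f /(sup_norm_le1 x0) f1 <-]; rewrite lee_fin.
  have -> : f = iter 2 poset_int (iter 2 poset_deriv f).
    by rewrite /= !poset_derivK.
  rewrite charge_integral_iter2; apply: le_trans (ler_norm_sum _ _ _) _.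
  (* The hockey-stick order is what removes this absolute value; [f1] then bounds the remaining
     factor by 1. *)
  apply: ler_sum => x _; rewrite normrM (ger0_norm (hs x)).
  by rewrite ler_piMl.
apply: ereal_sup_ubound; exists (iter 2 poset_int (cst 1)).
  by apply/(sup_norm_le1 x0) => x; rewrite /= !poset_intK normr1.
rewrite charge_integral_iter2; under eq_bigr do rewrite mul1r.
by rewrite ger0_norm// sumr_ge0.
Qed.
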